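(* Let $n,k$ be integers with $2\le k\le n-1$ and let $\mathbf a=a_1a_2\cdots a_n$ be a vertex of $G(n)$. If $\mathrm{st}(a_1a_2\cdots a_{n-k})=\mathrm{st}(a_{k+1}a_{k+2}\cdots a_n)$, then there exists a closed $k$-walk in $G(n)$ starting at $\mathbf a$.
   Context: For a sequence of distinct integers $c_1\cdots c_t$, $\mathrm{st}(c_1\cdots c_t)$ is the unique permutation $b_1\cdots b_t$ of $\{1,\dots,t\}$ with $b_i<b_j$ iff $c_i<c_j$. $G(n)$ is the directed multigraph whose vertices are the permutations of $\{1,\dots,n\}$ (one-line notation) and whose edges are the permutations $c_1\cdots c_{n+1}$ of $\{1,\dots,n+1\}$, the edge $c_1\cdots c_{n+1}$ going from $\mathrm{st}(c_1\cdots c_n)$ to $\mathrm{st}(c_2\cdots c_{n+1})$; so there is an edge from $a_1\cdots a_n$ to $b_1\cdots b_n$ iff $\mathrm{st}(a_2\cdots a_n)=\mathrm{st}(b_1\cdots b_{n-1})$. A closed $k$-walk starting at $v_1$ is a sequence $(v_1,e_1,v_2,\dots,v_k,e_k,v_1)$ with $e_i$ an edge from $v_i$ to $v_{i+1}$ (indices mod $k$). *)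

(* Defs.v *)
From mathcomp Require Import all_boot.
Set Implicit Arguments.
Unset Strict Implicit.
Unset Printing Implicit Defensive.

(* The rank formula; [st_perm], [st_order] and [st_unique] below show that, on
   words with distinct letters, it is the unique permutation of {1, ..., t} in
   the same relative order as the word. *)
Definition st (c : seq nat) : seq nat := [seq count (geq x) c | x <- c].

Lemma size_st c : size (st c) = size c.
Proof. exact: size_map. Qed.

Lemma nth_st c i : i < size c -> nth 0 (st c) i = count (geq (nth 0 c i)) c.
Proof. by move=> hi; rewrite (nth_map 0). Qed.

Lemma count_geq_ltn (c : seq nat) x y :
  y \in c -> x < y -> count (geq x) c < count (geq y) c.
Proof.
move=> yc xy.
have -> : count (geq y) c = count (geq x) c + count (fun z => x < z <= y) c.
  rewrite -(count_predUI (geq x)) [count (predI _ _) _](_ : _ = 0) ?addn0.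
    apply: eq_count => z /=; case: (leqP z x) => //= zx.
    by rewrite (leq_trans zx (ltnW xy)).
  by rewrite -[RHS](count_pred0 c); apply: eq_count => z /=; case: leqP.
rewrite -[X in X < _]addn0 ltn_add2l -has_count.
by apply/hasP; exists y => //=; rewrite xy leqnn.
Qed.

Lemma count_geq_mono (c : seq nat) x y :
  x \in c -> y \in c -> (count (geq x) c < count (geq y) c) = (x < y).
Proof.
move=> xc yc; case: (ltngtP x y) => [xy|yx|->]; last exact: ltnn.
- exact: count_geq_ltn.
- by apply/negbTE; rewrite -leqNgt ltnW // count_geq_ltn.
Qed.

Lemma st_order (c : seq nat) i j : i < size c -> j < size c ->
  (nth 0 (st c) i < nth 0 (st c) j) = (nth 0 c i < nth 0 c j).
Proof. by move=> hi hj; rewrite !nth_st // count_geq_mono // mem_nth. Qed.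

Lemma st_perm (c : seq nat) : uniq c -> perm_eq (st c) (iota 1 (size c)).
Proof.
move=> uc.
have ust : uniq (st c).
  rewrite map_inj_in_uniq // => x y xc yc exy.
  have := count_geq_mono xc yc; have := count_geq_mono yc xc.
  by rewrite exy ltnn; case: (ltngtP x y).
have sub : {subset st c <= iota 1 (size c)}.
  move=> _ /mapP[x xc ->]; rewrite mem_iota add1n ltnS count_size andbT.
  by rewrite -has_count; apply/hasP; exists x => //=.
apply: uniq_perm; rewrite ?iota_uniq //.
by case: (uniq_min_size ust sub); rewrite ?size_iota ?size_st.
Qed.

Lemma st_id n w : perm_eq w (iota 1 n) -> st w = w.
Proof.
move=> pw; rewrite -[RHS]map_id; apply/eq_in_map => x.
rewrite (perm_mem pw) mem_iota add1n ltnS => /andP[x0 xn].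
rewrite (permP pw) -(subnKC xn) iotaD count_cat.
have -> : count (geq x) (iota 1 x) = x.
  rewrite -[RHS](size_iota 1); apply/eqP; rewrite -all_count; apply/allP => z.
  by rewrite mem_iota add1n ltnS => /andP[].
rewrite [X in _ + X](_ : _ = 0) ?addn0 //.
apply/eqP; rewrite -leqn0 leqNgt -has_count; apply/hasPn => z.
by rewrite mem_iota add1n -ltnNge => /andP[].
Qed.

Lemma st_unique (b c : seq nat) : perm_eq b (iota 1 (size c)) ->
  (forall i j, i < size c -> j < size c ->
     (nth 0 b i < nth 0 b j) = (nth 0 c i < nth 0 c j)) ->
  b = st c.
Proof.
move=> pb ord; have sb : size b = size c by rewrite (perm_size pb) size_iota.
rewrite -(st_id pb); apply: (@eq_from_nth _ 0); first by rewrite !size_st.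
move=> i; rewrite size_st => hi; have hi' : i < size c by rewrite -sb.
rewrite !nth_st //.
rewrite -[X in count _ X = _](mkseq_nth 0) -[X in _ = count _ X](mkseq_nth 0).
rewrite /mkseq !count_map sb; apply: eq_in_count => j.
by rewrite mem_iota /= add0n => hj; rewrite leqNgt ord // -leqNgt.
Qed.

(* Permutations of {1, ..., n} in one-line notation. *)
Definition perm_word (n : nat) := {w : seq nat | perm_eq w (iota 1 n)}.

Lemma size_perm_word n (w : perm_word n) : size (val w) = n.
Proof. by rewrite (perm_size (valP w)) size_iota. Qed.

Lemma uniq_perm_word n (w : perm_word n) : uniq (val w).
Proof. by rewrite (perm_uniq (valP w)) iota_uniq. Qed.

Lemma st_prefix_perm n (c : perm_word n.+1) :
  perm_eq (st (take n (val c))) (iota 1 n).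
Proof.
have := st_perm (take_uniq n (uniq_perm_word c)).
by rewrite size_takel // size_perm_word.
Qed.

Lemma st_suffix_perm n (c : perm_word n.+1) :
  perm_eq (st (drop 1 (val c))) (iota 1 n).
Proof.
have := st_perm (drop_uniq 1 (uniq_perm_word c)).
by rewrite size_drop size_perm_word subn1.
Qed.

Record multidigraph := Multidigraph {
  vertex : Type;
  edge : Type;
  source : edge -> vertex;
  target : edge -> vertex
}.

Definition G (n : nat) : multidigraph :=
  @Multidigraph (perm_word n) (perm_word n.+1)
    (fun c => exist _ (st (take n (val c))) (st_prefix_perm c))
    (fun c => exist _ (st (drop 1 (val c))) (st_suffix_perm c)).

Definition word n (a : vertex (G n)) : seq nat := val (a : perm_word n).

(* [v] and [e] list the walk (v 0, e 0, v 1, ..., v (k-1), e (k-1), v 0), where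
   [ordS] is the successor modulo k; for k > 0 the first condition says that
   v 0 = a. *)
Definition closed_walk (H : multidigraph) (k : nat) (a : vertex H)
    (v : 'I_k -> vertex H) (e : 'I_k -> edge H) : Prop :=
  (forall i : 'I_k, i = 0 :> nat -> v i = a) /\
  (forall i : 'I_k, source (e i) = v i /\ target (e i) = v (ordS i)).

(* Main.v *)
(** Sliding a window of length n along a word w of n + k distinct letters gives
    a k-walk from the pattern of the first n letters of w to the pattern of the
    last n.  It is closed at a as soon as both patterns are a; such a w is an
    amalgam of two copies of the linear order a along the last n - k positions
    of the first and the first n - k positions of the second, which the
    hypothesis makes order isomorphic. *)
Require Import Defs.
From mathcomp Require Import all_boot.
From mathcomp Require Import zify.

Lemma st_map (f : nat -> nat) (c : seq nat) :
  {in c &, {mono f : x y / x < y}} -> st (map f c) = st c.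
Proof.
move=> fm; rewrite /st -map_comp; apply/eq_in_map => x xc /=.
by rewrite count_map; apply: eq_in_count => y yc /=; rewrite leqNgt fm // -leqNgt.
Qed.

Lemma st_eq_order (b c : seq nat) : st b = st c ->
  forall i j, i < size b -> j < size b ->
    (nth 0 b i < nth 0 b j) = (nth 0 c i < nth 0 c j).
Proof.
move=> e i j hi hj; have sz : size b = size c by rewrite -size_st e size_st.
by rewrite -(st_order hi hj) -(@st_order c) -?sz // e.
Qed.

(** Ranks are strictly monotone on the letters of [c]. With [st_drop_st], this lets the ends of an
    edge be read directly off the long word. *)
Lemma st_take_st m (c : seq nat) : st (take m (st c)) = st (take m c).
Proof.
rewrite -map_take; apply: st_map => x y /mem_take xc /mem_take yc.
exact: count_geq_mono.
Qed.

Lemma st_drop_st m (c : seq nat) : st (drop m (st c)) = st (drop m c).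
Proof.
rewrite -map_drop; apply: st_map => x y /mem_drop xc /mem_drop yc.
exact: count_geq_mono.
Qed.

(* Letters of [p ++ s] are sent to distinct positive multiples of a large [M];
   a letter [x] of [r] is put strictly between the multiple given by the
   largest letter of [t] below [x] and the next multiple, at offset [x.+1]. *)
Lemma st_amalgam (p s t r : seq nat) :
  uniq (p ++ s) -> uniq (t ++ r) -> st s = st t ->
  exists p' s' r' : seq nat,
    [/\ uniq (p' ++ s' ++ r'),
        [/\ size p' = size p, size s' = size s & size r' = size r],
        st (p' ++ s') = st (p ++ s) & st (s' ++ r') = st (t ++ r)].
Proof.
move=> ups utr est.
have sz : size s = size t by rewrite -size_st est size_st.
have ord := st_eq_order _ _ est.
have [M M0 ltM] : exists2 M, 0 < M & forall x, x \in r -> x.+1 < M.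
  exists (\max_(x <- r) x).+2 => // x xr.
  by rewrite !ltnS (leq_bigmax_seq x).
pose h y := M * y.+1.
have hm : {mono h : x y / x < y} by move=> x y; rewrite /h ltn_pmul2l.
(* The empty maximum is 0, so a letter of [r] below all of [t] lands below [M], while the successor
   in [h] keeps every multiple at least [M]. *)
pose b x := \max_(i < size t | nth 0 t i < x) (nth 0 s i).+1.
pose g x := M * b x + x.+1.
pose f x := if x \in t then h (nth 0 s (index x t)) else g x.
(* Both words thus share the middle block [map h s]. *)
have ft : map f t = map h s.
  apply: (@eq_from_nth _ 0); rewrite !size_map -?sz // => i hi.
  rewrite !(nth_map 0) -?sz // /f mem_nth -?sz // index_uniq -?sz //.
  by move: utr; rewrite cat_uniq => /andP[].
have rNt x : x \in r -> x \notin t.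
  by move: utr; rewrite cat_uniq => /and3P[_ /hasPn + _] => /[apply].
have fr : map f r = map g r.
  by apply/eq_in_map => x xr; rewrite /f (negbTE (rNt _ xr)).
have b_le x y : x <= y -> b x <= b y.
  move=> xy; apply/bigmax_leqP => i ix.
  by apply: (bigmax_sup i) => //; apply: leq_trans xy.
have g_lt x y : x < y -> g x < g y.
  by move=> xy; rewrite /g -addnS leq_add // leq_mul2l b_le ?orbT // ltnW.
have t_lt_r x y : x \in t -> x < y -> f x < g y.
  move=> xt xy; rewrite /f xt /h /g.
  have xs : index x t < size t by rewrite index_mem.
  have : (nth 0 s (index x t)).+1 <= b y.
    by apply: (bigmax_sup (Ordinal xs)) => //=; rewrite nth_index.
  rewrite -(leq_pmul2l M0); lia.
have r_lt_t x y : x \in r -> y \in t -> x < y -> g x < f y.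
  move=> xr yt xy; rewrite /f yt /h /g.
  have ys : index y t < size t by rewrite index_mem.
  (* Letters of [t] below [x] are below [y], so by [ord] their partners in [s] are below that of
     [y]; the offset [x.+1 < M] cannot reach [f y]. *)
  have : b x <= nth 0 s (index y t).
    apply/bigmax_leqP => i ix; rewrite ord ?sz //.
    by rewrite nth_index // (ltn_trans ix xy).
  rewrite -(leq_pmul2l M0) mulnS; have := ltM _ xr; lia.
have f_lt : {in t ++ r &, forall x y, x < y -> f x < f y}.
  move=> x y; rewrite !mem_cat => /orP[xt|xr] /orP[yt|yr] xy.
  - rewrite /f xt yt hm ord ?sz ?index_mem //.
    by rewrite !nth_index.
  - by rewrite [f y]/f (negbTE (rNt _ yr)); exact: t_lt_r.
  - by rewrite [f x]/f (negbTE (rNt _ xr)); exact: r_lt_t.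
  - by rewrite /f (negbTE (rNt _ xr)) (negbTE (rNt _ yr)) g_lt.
have fm : {in t ++ r &, {mono f : x y / x < y}}.
  move=> x y xc yc; case: (ltngtP x y) => [xy|yx|->]; last exact: ltnn.
  - exact: f_lt.
  - by apply/negbTE; rewrite -leqNgt ltnW // f_lt.
exists (map h p), (map h s), (map g r); split.
- rewrite catA cat_uniq -map_cat; apply/and3P; split.
  + rewrite map_inj_uniq // => x y /eqP.
    by rewrite /h eqn_pmul2l // eqSS => /eqP.
  + apply/hasPn => _ /mapP[x xr ->]; apply/negP => /mapP[y _].
    (* Modulo [M], values of [h] vanish, while [g x] leaves the nonzero residue [x.+1]. *)
    move/(congr1 (modn^~ M)); rewrite /g /h modnMr mulnC modnMDl modn_small //.
    exact: ltM.
  + rewrite map_inj_in_uniq; first by move: utr; rewrite cat_uniq => /and3P[].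
    move=> x y _ _ exy; case: (ltngtP x y) => // /g_lt; by rewrite exy ltnn.
- by rewrite !size_map.
- by rewrite -map_cat; apply: st_map => x y _ _; exact: hm.
- by rewrite -ft -fr -map_cat st_map.
Qed.

Lemma st_window_perm (w : seq nat) i m : uniq w -> i + m <= size w ->
  perm_eq (st (take m (drop i w))) (iota 1 m).
Proof.
move=> uw le; have := st_perm (take_uniq m (drop_uniq i uw)).
by rewrite size_takel // size_drop; lia.
Qed.

(** Length [n] yields the vertices of the walk in [G n], length [n.+1] its edges. *)
Definition window (w : seq nat) i m (uw : uniq w) (le : i + m <= size w) :
    perm_word m :=
  exist _ (st (take m (drop i w))) (st_window_perm w i m uw le).

Lemma closed_walk_of_word n k (w : seq nat) (a : vertex (G n)) :
  uniq w -> size w = n + k ->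
  st (take n w) = word a -> st (drop k w) = word a ->
  exists (v : 'I_k -> vertex (G n)) (e : 'I_k -> edge (G n)),
    closed_walk a v e.
Proof.
move=> uw sw e0 ek.
have vP (i : 'I_k) : i + n <= size w by have := ltn_ord i; lia.
have eP (i : 'I_k) : i + n.+1 <= size w by have := ltn_ord i; lia.
exists (fun i => window _ _ _ uw (vP i)).
exists (fun i => window _ _ _ uw (eP i)).
split=> [i i0|i]; first by apply: val_inj; rewrite /= i0 drop0 e0.
split; apply: val_inj => /=.
  by rewrite st_take_st take_takel.
rewrite st_drop_st -[n.+1]addn1 -take_drop drop_drop add1n.
(* At [i = k - 1] the successor wraps to 0: the target is the window at position [k], whose pattern
   is that of the first window. *)
have := ltn_ord i; rewrite leq_eqVlt => /orP[/eqP ik|ik]; last by rewrite modn_small.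
rewrite ik modnn drop0 e0 -ek take_oversize // size_drop; lia.
Qed.

Theorem theorem3p3 (n k : nat) (hk : 2 <= k <= n - 1) (a : vertex (G n)) :
  st (take (n - k) (word a)) = st (drop k (word a)) ->
  exists (v : 'I_k -> vertex (G n)) (e : 'I_k -> edge (G n)),
    closed_walk a v e.
Proof.
move=> /esym est.
have ua : uniq (word a) := uniq_perm_word a.
have sa : size (word a) = n := size_perm_word a.
(* One copy of [a] is cut after [k] letters, the other after [n - k]; the end of the first is glued
   to the start of the second. *)
have [] := st_amalgam (take k (word a)) _ _ (drop (n - k) (word a)) _ _ est;
  rewrite ?cat_take_drop // => p [s [r [uw [sp ss sr] e1 e2]]].
have ea : st (word a) = word a := st_id (valP a).
move: sp ss sr; rewrite size_take !size_drop sa => sp ss sr.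
have sk : size p = k by rewrite sp; case: ifP; lia.
apply: (closed_walk_of_word _ _ (p ++ s ++ r)) => //.
- by rewrite !size_cat; lia.
- by rewrite catA take_size_cat ?e1 // size_cat; lia.
- by rewrite drop_size_cat ?e2.
Qed.
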